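(* Let $m,n\ge1$ and $a,b\ge0$ be given integers. Then $G^+_{d,m,a,b}(n)$, as a function of the positive integer $d$, is a polynomial in $d$ of degree $2a+b+\lfloor\frac{n+1}{2}\rfloor$.
   Context: For integers $d\ge1$, $n\ge0$ let $\mathcal{A}_{d,n}=\{(i,j):1\le i\le d,\ 1\le j\le n\}$. A subset $I\subseteq\mathcal{A}_{d,n}$ is nice if (1) $(i+1,j)\in I$ with $i\ge1$ implies $(i,j)\in I$, and (2) $(1,j)\in I$ with $1\le j\le n-1$ implies $(1,j+1)\notin I$. $\mathcal{B}^+_{d,n}$ is the set of nice subsets of $\mathcal{A}_{d,n}$. For $I$ nice, $|I|$ is its cardinality and $\sigma_m(I)=\sum_{(i,j)\in I}((i-1)m+j)$. Define $G^+_{d,m,a,b}(n)=\sum_{I\in\mathcal{B}^+_{d,n}}\sigma_m(I)^a|I|^b$ (with $0^0=1$). *)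

(* Defs.v *)
From mathcomp Require Import all_boot.

Set Implicit Arguments.
Unset Strict Implicit.
Unset Printing Implicit Defensive.

Section NiceSubsets.

Variables d n : nat.

(* A cell (i, j), 1 <= i <= d and 1 <= j <= n, is stored 0-based as           *)
(* (i - 1, j - 1); [cell_row] and [cell_col] return i and j.                  *)
Definition cell : finType := ('I_d * 'I_n)%type.

Definition cell_row (c : cell) : nat := c.1.+1.
Definition cell_col (c : cell) : nat := c.2.+1.

(* The side conditions 1 <= i and 1 <= j <= n - 1 hold automatically, since    *)
(* both cells involved range over the grid.                                    *)
Definition nice (I : {set cell}) : bool :=
  [forall c : cell, forall c' : cell,
     [&& cell_row c' == (cell_row c).+1, cell_col c' == cell_col c & c' \in I] ==> (c \in I)]
  && [forall c : cell, forall c' : cell,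
     [&& cell_row c == 1, cell_row c' == 1, cell_col c' == (cell_col c).+1 & c \in I]
       ==> (c' \notin I)].

Definition nice_subsets : {set {set cell}} := [set I | nice I].

Definition sigma (m : nat) (I : {set cell}) : nat :=
  \sum_(c in I) ((cell_row c - 1) * m + cell_col c).

End NiceSubsets.

(* [expn] satisfies 0 ^ 0 = 1. *)
Definition Gplus (d m a b n : nat) : nat :=
  \sum_(I in nice_subsets d n) sigma m I ^ a * #|I| ^ b.

(* Main.v *)
(* A nice set is determined by its column heights h_1, ..., h_n <= d, no two    *)
(* adjacent ones being nonzero.  Expanding both powers and summing over the     *)
(* heights with a fixed support S gives, independently of d, finitely many      *)
(* products of one-column sums; each product is a polynomial in d of degree at  *)
(* most 2a + b + |S| with nonnegative coefficient there.  As S contains no two  *)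
(* adjacent columns, |S| <= (n + 1) / 2; the columns 1, 3, 5, ... attain this,  *)
(* and putting all a + b factors on column 1 gives a positive coefficient.      *)
Require Import Defs.
From mathcomp Require Import all_boot all_order all_algebra.
From mathcomp Require Import zify ring.

Import Order.TTheory Num.Theory.
Import GRing.Theory.
Local Open Scope ring_scope.

Set Implicit Arguments.
Unset Strict Implicit.
Unset Printing Implicit Defensive.

(** Niceness becomes sparseness of the support of the heights ([sum_nice]). Expanding both powers
    over words ([expr_sum_ffun]) and fixing the support [S] leaves products over columns, with index
    sets free of [d] ([sum_supp]). A column's weight is quadratic in its height, so [E] weights and
    [F] heights, summed over heights 1 to [d], give degree [2 * E + F + 1] ([poly_growth_factor]);
    an empty column gives 0 or 1. The degrees add up to at most [2 * a + b + #|S|], and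
    [sparse_card] bounds [#|S|]. No top coefficient is negative, so one positive term, with
    [S = evens n] and constant words, settles the degree. *)

(** Induction on [k], splitting off a multiple of a polynomial whose shifted values are differences
    of consecutive powers and hence telescope. *)
Lemma sum_horner (R : numFieldType) (e : R) (k : nat) (p : {poly R}) :
  (size p <= k.+1)%N ->
  exists q : {poly R}, [/\ (size q <= k.+2)%N, q`_k.+1 = p`_k / k.+1%:R
    & forall d : nat, q.[d%:R] = \sum_(i < d) p.[i%:R + e]].
Proof.
(* ('X - e + 1) ^+ k0.+1 - ('X - e) ^+ k0.+1 telescopes, and factoring it as a *)
(* difference of powers shows that it is a sum of k0.+1 monics of degree k0.   *)
have diff_pow k0 : exists h : {poly R}, [/\ (size h <= k0.+1)%N,
    h`_k0 = k0.+1%:R & forall x, h.[x + e] = (x + 1) ^+ k0.+1 - x ^+ k0.+1].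
  have sz_term (i : 'I_k0.+1) :
      ('X - (e - 1)%:P) ^+ (k0 - i) * ('X - e%:P) ^+ i \is monic /\
      size (('X - (e - 1)%:P) ^+ (k0 - i) * ('X - e%:P) ^+ i) = k0.+1.
    split; first by rewrite monicMl ?monic_exp ?monicXsubC.
    rewrite size_monicM ?monic_exp ?monicXsubC // ?size_exp_XsubC.
      by have := ltn_ord i; lia.
    by rewrite monic_neq0 // monic_exp ?monicXsubC.
  exists (\sum_(i < k0.+1) ('X - (e - 1)%:P) ^+ (k0 - i) * ('X - e%:P) ^+ i).
  split.
  - rewrite (leq_trans (size_sum _ _ _)) //; apply/bigmax_leqP => i _.
    by rewrite (sz_term i).2.
  - rewrite coef_sum (eq_bigr (fun=> 1)) ?sumr_const ?card_ord // => i _.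
    by have [/monicP + sz] := sz_term i; rewrite lead_coefE sz.
  - move=> x; rewrite subrXX addrAC subrr add0r mul1r horner_sum.
    apply: eq_bigr => i _; rewrite !hornerE.
    by congr (_ ^+ _ * _ ^+ _); ring.
have telescope k0 d :
    \sum_(i < d) ((i%:R + 1) ^+ k0.+1 - i%:R ^+ k0.+1) = d%:R ^+ k0.+1 :> R.
  elim: d => [|d IH]; first by rewrite big_ord0 expr0n.
  by rewrite big_ord_recr /= IH natr1 addrC subrK.
elim: k p => [|k IH] p sz_p.
  exists (p`_0 *: 'X); split.
  - by rewrite (leq_trans (size_scale_leq _ _)) ?size_polyX.
  - by rewrite coefZ coefX mulr1 divr1.
  - move=> d; rewrite (size1_polyC sz_p) coefC eqxx.
    rewrite (eq_bigr (fun=> p`_0)) => [|i _]; last by rewrite hornerC.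
    by rewrite sumr_const card_ord !hornerE mulr_natr.
have [h [sz_h h_k hE]] := diff_pow k.+1.
(* [c] cancels the coefficient at [k.+1]; the part removed sums to [c * d ^ k.+2]. *)
set c := p`_k.+1 / k.+2%:R.
have [|q [sz_q q_k qE]] := IH (p - c *: h).
  apply/leq_sizeP => j; rewrite leq_eqVlt => /orP[/eqP<-|lt_j].
    by rewrite coefB coefZ h_k /c divfK ?subrr // pnatr_eq0.
  rewrite coefB coefZ (leq_sizeP _ _ sz_p) // (leq_sizeP _ _ sz_h) //.
  by rewrite mulr0 subrr.
exists (q + c *: 'X^(k.+2)); split.
- apply: (leq_trans (size_polyD _ _)); rewrite geq_max; apply/andP; split.
    exact: leqW.
  by rewrite (leq_trans (size_scale_leq _ _)) ?size_polyXn.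
- by rewrite coefD coefZ coefXn eqxx mulr1 nth_default ?add0r.
- move=> d; rewrite hornerD qE hornerZ hornerXn -telescope mulr_sumr -big_split.
  by apply: eq_bigr => i _; rewrite /= !hornerE hE subrK.
Qed.

(* [f] agrees with a polynomial of degree at most [k] whose coefficient at [k] *)
(* is nonnegative, and positive when [s] holds: such functions can be added    *)
(* and multiplied without cancellation of their top coefficients.              *)
Definition poly_growth (s : bool) (k : nat) (f : nat -> rat) : Prop :=
  exists p : {poly rat}, [/\ (size p <= k.+1)%N, 0 < p`_k ?<= if ~~ s
    & forall d : nat, f d = p.[d%:R]].

(** * Closure properties of [poly_growth] *)

Lemma eq_poly_growth s k (f g : nat -> rat) :
  f =1 g -> poly_growth s k f -> poly_growth s k g.
Proof. by move=> fg [p [? ? pE]]; exists p; split=> // d; rewrite -fg. Qed.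

Lemma poly_growthW k l s (f : nat -> rat) :
  (k <= l)%N -> poly_growth s k f -> poly_growth (s && (k == l)) l f.
Proof.
move=> le_kl [p [sz_p p_k pE]]; exists p; split=> //; first exact: leq_trans sz_p _.
move: le_kl; rewrite leq_eqVlt => /predU1P[<-|lt_kl]; first by rewrite eqxx andbT.
by rewrite ltn_eqF // andbF nth_default //= (leq_trans sz_p).
Qed.

Lemma poly_growth_cst (c : rat) : 0 <= c -> poly_growth (c != 0) 0 (fun=> c).
Proof.
move=> c_ge0; exists c%:P; split=> [||d]; rewrite ?hornerC //.
  exact: size_polyC_leq1.
rewrite coefC eqxx; case: eqVneq => [->|c_neq0] //=.
by rewrite lt_def c_neq0.
Qed.

Lemma poly_growth_id : poly_growth true 1 (fun d => d%:R).
Proof. by exists 'X; split=> [||d]; rewrite ?size_polyX ?coefX ?hornerX. Qed.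

Lemma poly_growth0 s k : ~~ s -> poly_growth s k (fun=> 0).
Proof.
by case: s => // _; exists 0; split=> [||d]; rewrite ?size_poly0 ?coef0 ?horner0.
Qed.

Lemma poly_growthS s t k (f : nat -> rat) :
  poly_growth t k f -> poly_growth (t && s) k f.
Proof.
move=> [p [sz_p p_k pE]]; exists p; split=> //.
by case: t s p_k => [] [] //=; exact: ltW.
Qed.

Lemma poly_growthD s t k (f g : nat -> rat) :
  poly_growth s k f -> poly_growth t k g ->
  poly_growth (s || t) k (fun d => f d + g d).
Proof.
move=> [p [sz_p p_k pE]] [q [sz_q q_k qE]]; exists (p + q).
split=> [||d]; last by rewrite hornerD pE qE.
  by rewrite (leq_trans (size_polyD _ _)) // geq_max sz_p.
rewrite coefD; case: s t p_k q_k => [] [] /= p_k q_k.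
- exact: addr_gt0.
- exact: ltr_wpDr.
- exact: ltr_wpDl.
- exact: addr_ge0.
Qed.

Lemma poly_growthM s t k l (f g : nat -> rat) :
  poly_growth s k f -> poly_growth t l g ->
  poly_growth (s && t) (k + l) (fun d => f d * g d).
Proof.
move=> [p [sz_p p_k pE]] [q [sz_q q_k qE]]; exists (p * q).
split=> [||d]; last by rewrite hornerM pE qE.
  by apply: leq_trans (size_polyMleq _ _) _; lia.
have -> : (p * q)`_(k + l) = p`_k * q`_l.
  rewrite coefM (bigD1 (inord k)) //= inordK ?ltnS ?leq_addr // addKn.
  rewrite big1 ?addr0 // => i ne_ik.
  have {}ne_ik : (i : nat) != k.
    apply: contraNneq ne_ik => ik; rewrite -val_eqE /= inordK ?ik //.
    by rewrite ltnS leq_addr.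
  case: (ltnP k i) => ki; first by rewrite nth_default ?mul0r // (leq_trans sz_p).
  by rewrite [q`_ _]nth_default ?mulr0 // (leq_trans sz_q) // ltn_subRL; lia.
case: s t p_k q_k => [] [] /= p_k q_k.
- exact: mulr_gt0.
- by rewrite mulr_ge0 // ltW.
- by rewrite mulr_ge0 // ltW.
- exact: mulr_ge0.
Qed.

Lemma poly_growthX s k (f : nat -> rat) e :
  poly_growth s k f -> poly_growth (s || (e == 0%N)) (k * e) (fun d => f d ^+ e).
Proof.
move=> fP; elim: e => [|e IH].
  by rewrite muln0 orbT -(@oner_neq0 rat); exact: poly_growth_cst.
rewrite mulnS orbF; case: s fP IH => fP IH;
  by apply: eq_poly_growth (poly_growthM fP IH) => d; rewrite exprS.
Qed.

(** Only [i0] has to supply a positive top coefficient. Keeping [s] in each summand's flag allows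
    nesting over several indices. *)
Lemma poly_growth_sum (I : finType) (P : pred I) (i0 : I) s k
    (F : I -> nat -> rat) :
  P i0 -> (forall i, P i -> poly_growth (s && (i == i0)) k (F i)) ->
  poly_growth s k (fun d => \sum_(i | P i) F i d).
Proof.
move=> Pi0 FP.
apply: (@eq_poly_growth _ _ (fun d => F i0 d + \sum_(i | P i && (i != i0)) F i d)).
  by move=> d; rewrite [RHS](bigD1 i0).
rewrite -[s]orbF; apply: poly_growthD.
  by have := FP i0 Pi0; rewrite eqxx andbT.
elim: (index_enum I) => [|i r IH].
  by apply: eq_poly_growth (poly_growth0 k (s := false) isT) => d; rewrite big_nil.
have [/andP[Pi ne_i]|/negPf P'i] := boolP (P i && (i != i0)); last first.
  by apply: eq_poly_growth IH => d; rewrite big_cons P'i.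
have := FP i Pi; rewrite (negPf ne_i) andbF => FiP.
by apply: eq_poly_growth (poly_growthD FiP IH) => d; rewrite big_cons Pi ne_i.
Qed.

Lemma poly_growth_prod (I : finType) s (k : I -> nat) (F : I -> nat -> rat) :
  (forall i, poly_growth s (k i) (F i)) ->
  poly_growth s (\sum_i k i) (fun d => \prod_i F i d).
Proof.
move=> FP; elim: (index_enum I) => [|i r IH].
  have := poly_growthS s (poly_growth_cst (@ler01 rat)).
  rewrite oner_neq0 andTb big_nil.
  by apply: eq_poly_growth => d; rewrite big_nil.
rewrite -[s]andbb big_cons.
by apply: eq_poly_growth (poly_growthM (FP i) IH) => d; rewrite big_cons.
Qed.

Lemma poly_growth_psum (e : nat) s k (f : nat -> rat) :
  poly_growth s k f ->
  poly_growth s k.+1 (fun d => \sum_(i < d) f (i + e)%N).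
Proof.
move=> [p [sz_p p_k pE]].
have [q [sz_q q_k qE]] := sum_horner e%:R sz_p.
exists q; split=> [||d] //; last first.
  by rewrite qE; apply: eq_bigr => i _; rewrite pE natrD.
by rewrite q_k; case: s p_k => /= ?; rewrite ?divr_gt0 ?divr_ge0.
Qed.

(** * Nice sets as column heights *)

Lemma card_ord_lt d k : (k <= d)%N -> #|[set i : 'I_d | (i < k)%N]| = k.
Proof.
move=> le_kd; rewrite -sum1_card (eq_bigl (fun i : 'I_d => (i < k)%N)).
  by rewrite -(big_ord_widen d (fun=> 1%N) le_kd) sum1_card card_ord.
by move=> i; rewrite inE.
Qed.

Section Diagrams.

Variables d n : nat.

Implicit Types (h : {ffun 'I_n -> 'I_d.+1}) (I : {set cell d n}).

Definition diagram h : {set cell d n} := [set c : cell d n | (c.1 < h c.2)%N].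

Definition heights I : {ffun 'I_n -> 'I_d.+1} :=
  [ffun j => inord #|[set i | (i, j) \in I]|].

Definition supp h : {set 'I_n} := [set j | h j != ord0].

Definition sparse (S : {set 'I_n}) : bool :=
  [forall j : 'I_n, forall j' : 'I_n,
    (j' == j.+1 :> nat) && (j \in S) ==> (j' \notin S)].

Lemma diagramK : cancel diagram heights.
Proof.
move=> h; apply/ffunP => j; rewrite ffunE; apply/val_inj.
have -> : [set i | (i, j) \in diagram h] = [set i : 'I_d | (i < h j)%N].
  by apply/setP => i; rewrite !inE.
by rewrite card_ord_lt ?inord_val // -ltnS.
Qed.

(** Each column of a nice set is an initial segment, hence determined by its cardinality. *)
Lemma heightsK I : nice I -> diagram (heights I) = I.
Proof.
case/andP => /'forall_forallP down _.
have downI (j : 'I_n) (i i' : 'I_d) :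
    (i <= i')%N -> (i', j) \in I -> (i, j) \in I.
  move: i' => [k k_lt]; elim: k k_lt => [|k IH] k_lt /= le_ik kI.
    suff -> : i = Ordinal k_lt by [].
    by apply/val_inj/eqP; rewrite -leqn0.
  move: le_ik; rewrite leq_eqVlt => /predU1P[ik|lt_ik].
    by suff -> : i = Ordinal k_lt by []; apply/val_inj.
  apply: (IH (ltnW k_lt)) => //=.
  apply: (implyP (down (Ordinal (ltnW k_lt), j) (Ordinal k_lt, j))).
  by rewrite /cell_row /cell_col !eqxx.
apply/setP => -[i j]; rewrite inE ffunE /= inordK; last first.
  by rewrite ltnS (leq_trans (max_card _)) ?card_ord.
have [ijI|ijNI] := boolP ((i, j) \in I).
  rewrite -[X in (X <= _)%N](card_ord_lt (ltn_ord i)); apply: subset_leq_card.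
  by apply/subsetP => i'; rewrite !inE => le_i; apply: downI ijI.
apply/negbTE; rewrite -leqNgt -[X in (_ <= X)%N](card_ord_lt (ltnW (ltn_ord i))).
apply/subset_leq_card/subsetP => i'; rewrite !inE ltnNge; apply: contraL.
by move=> le_i; apply: contra ijNI; apply: downI.
Qed.

Lemma nice_diagram h : nice (diagram h) = sparse (supp h).
Proof.
apply/andP/'forall_forallP => [[_ /'forall_forallP sep] j j'|sep].
  apply/implyP => /andP[/eqP jj']; rewrite !inE negbK => hj.
  (* A nonzero height forces [d > 0], so there are first-row cells to apply [sep] to. *)
  have d_gt0 : (0 < d)%N.
    by rewrite -ltnS (leq_trans _ (ltn_ord (h j))) // ltnS lt0n.
  have := sep (Ordinal d_gt0, j) (Ordinal d_gt0, j').
  by rewrite /cell_row /cell_col jj' !inE /= !eqxx lt0n hj /= -eqn0Ngt.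
split; apply/'forall_forallP => -[i j] [i' j'].
  apply/implyP => /and3P[/eqP[ii'] /eqP[/val_inj jj']].
  by rewrite !inE /= ii' jj'; apply: ltnW.
apply/implyP => /and4P[/eqP[i0] /eqP[i'0] /eqP[jj']].
rewrite !inE /= i0 i'0 -leqNgt leqn0 lt0n => hj.
by have /implyP := sep j j'; rewrite !inE negbK jj' eqxx; apply.
Qed.

Lemma sum_nice (V : nmodType) (F : {set cell d n} -> V) :
  \sum_(I in nice_subsets d n) F I = \sum_(h | sparse (supp h)) F (diagram h).
Proof.
rewrite (reindex_onto diagram heights) => [|I]; last by rewrite inE => /heightsK.
by apply: eq_bigl => h; rewrite inE nice_diagram diagramK eqxx andbT.
Qed.

Lemma sum_diagram (F : nat -> nat -> nat) h :
  (\sum_(c in diagram h) F c.1 c.2 = \sum_j \sum_(i < h j) F i j)%N.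
Proof.
transitivity (\sum_(j < n) \sum_(i < d | (i < h j)%N) F i j)%N.
  rewrite (exchange_big_dep predT) //= pair_big_dep /=.
  by apply: eq_bigl => c; rewrite inE.
by apply: eq_bigr => j _; rewrite (big_ord_widen d (F^~ j)) // -ltnS.
Qed.

End Diagrams.

(* Contribution to [sigma] of the first [h] cells of the column stored as [j],  *)
(* that is, of column number [j.+1].                                            *)
Definition colweight (m j h : nat) : nat := (\sum_(i < h) (i * m + j.+1))%N.

Lemma Gplus_heights d m a b n :
  Gplus d m a b n =
    (\sum_(h : {ffun 'I_n -> 'I_d.+1} | sparse (supp h))
      (\sum_(j < n) colweight m j (h j)) ^ a * (\sum_(j < n) h j) ^ b)%N.
Proof.
rewrite /Gplus sum_nice; apply: eq_bigr => h _; congr (_ ^ _ * _ ^ _)%N.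
  rewrite /sigma -(sum_diagram (fun i j => i * m + j.+1)%N).
  by apply: eq_bigr => c _; rewrite /cell_row subn1.
rewrite -sum1_card (sum_diagram (fun _ _ => 1%N)).
by apply: eq_bigr => j _; rewrite sum1_card card_ord.
Qed.

(** * Expansion into products over columns *)

Lemma expr_sum_ffun (R : comPzSemiRingType) (I : finType) (x : I -> R) a :
  (\sum_i x i) ^+ a =
    \sum_(e : {ffun 'I_a -> I}) \prod_i x i ^+ #|[set k | e k == i]|.
Proof.
rewrite -[in LHS](card_ord a) -prodr_const bigA_distr_bigA /=.
apply: eq_bigr => e _; rewrite (partition_big e predT) //=.
apply: eq_bigr => i _; rewrite (eq_bigr (fun=> x i)) => [|k /eqP->//].
by rewrite prodr_const; congr (_ ^+ _); apply: eq_card => k; rewrite !inE.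
Qed.

Lemma sum_fiber_card (I : finType) a (e : {ffun 'I_a -> I}) :
  (\sum_i #|[set k | e k == i]| = a)%N.
Proof.
rewrite -[RHS]card_ord -sum1_card (partition_big e predT) //=.
by apply: eq_bigr => i _; rewrite -sum1_card; apply: eq_bigl => k; rewrite inE.
Qed.

(** With the support fixed, the columns choose their heights independently: any [x + 1] on [S], 0
    elsewhere. *)
Lemma sum_supp (R : comPzSemiRingType) d n (S : {set 'I_n})
    (F : 'I_n -> nat -> R) :
  \sum_(h : {ffun 'I_n -> 'I_d.+1} | supp h == S) \prod_j F j (h j) =
    \prod_j (if j \in S then \sum_(x < d) F j (x + 1)%N else F j 0%N).
Proof.
transitivity (\prod_j \sum_(x < d.+1 | (x != ord0) == (j \in S)) F j x).
  rewrite bigA_distr_big_dep; apply: eq_bigl => h.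
  apply/eqP/familyP => [<- j|hS]; first by rewrite unfold_in inE.
  by apply/setP => j; have := hS j; rewrite inE unfold_in => /eqP.
apply: eq_bigr => j _; rewrite big_mkcond big_ord_recl /=.
case: (j \in S) => /=; last by rewrite big1 ?addr0.
by rewrite add0r; apply: eq_bigr => x _; rewrite addn1.
Qed.

(** Each pair of stored columns [2t], [2t + 1] meets [S] at most once. *)
Lemma sparse_card n (S : {set 'I_n}) : sparse S -> (#|S| <= (n + 1) %/ 2)%N.
Proof.
move=> /'forall_forallP sep.
have half_lt (j : 'I_n) : (j %/ 2 < (n + 1) %/ 2)%N by have := ltn_ord j; lia.
pose f j := Ordinal (half_lt j).
rewrite -[X in (_ <= X)%N]card_ord -(@card_in_imset _ _ f) ?max_card //.
suff inj (i j : 'I_n) : i \in S -> j \in S -> (i <= j)%N -> f i = f j -> i = j.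
  move=> i j iS jS fij; case: (leqP i j) => [|/ltnW] lij; first exact: inj.
  by apply/esym/inj.
move=> iS jS le_ij [] eq_ij; apply/val_inj => /=.
have := sep i j; rewrite iS jS andbT implybF => /eqP ne_ij.
by lia.
Qed.

(** Storage is 0-based: these are columns 1, 3, 5, and so on. *)
Definition evens n : {set 'I_n} := [set j : 'I_n | ~~ odd j].

Lemma sparse_evens n : sparse (evens n).
Proof.
apply/'forall_forallP => i j; apply/implyP => /andP[/eqP ij].
by rewrite !inE ij /= negbK.
Qed.

Lemma card_evens n : #|evens n| = ((n + 1) %/ 2)%N.
Proof.
apply/eqP; rewrite eqn_leq sparse_card ?sparse_evens //=.
have dbl_lt (i : 'I_((n + 1) %/ 2)) : (2 * i < n)%N by have := ltn_ord i; lia.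
pose f i := Ordinal (dbl_lt i).
rewrite -[X in (X <= _)%N]card_ord -(@card_imset _ _ f).
  apply/subset_leq_card/subsetP => _ /imsetP[i _ ->].
  by rewrite inE /= oddM.
by move=> i j [] eq_ij; apply/val_inj => /=; lia.
Qed.

(** * Degree count for one column, then for the whole sum *)

Lemma poly_growth_colweight m j :
  (1 <= m)%N -> poly_growth true 2 (fun h => (colweight m j h)%:R).
Proof.
move=> m_gt0.
have m_neq0 : m%:R != 0 :> rat by rewrite pnatr_eq0 -lt0n.
have linP : poly_growth true 1 (fun i => i%:R * m%:R + j.+1%:R).
  have mP := poly_growthM poly_growth_id (poly_growth_cst (ler0n _ m)).
  have cP := poly_growthW (leq0n 1) (poly_growth_cst (ler0n rat j.+1)).
  by have := poly_growthD mP cP; rewrite m_neq0.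
apply: eq_poly_growth (poly_growth_psum 0 linP) => h.
rewrite natr_sum; apply: eq_bigr => i _.
by rewrite addn0 natrD natrM.
Qed.

Definition column_term (m j E F x : nat) : rat :=
  (colweight m j x)%:R ^+ E * x%:R ^+ F.

(** Off the support the factor is the constant [0 ^ (E + F)], so it is positive in the stated degree
    only if both exponents vanish. *)
Lemma poly_growth_factor m j E F (s inS : bool) :
  (1 <= m)%N -> (s -> ~~ inS -> E = 0%N /\ F = 0%N) ->
  poly_growth s (2 * E + F + inS)
    (fun d => if inS then \sum_(x < d) column_term m j E F (x + 1)
              else column_term m j E F 0).
Proof.
move=> m_gt0.
have GP : poly_growth true (2 * E + F) (column_term m j E F).
  have := poly_growthM (poly_growthX E (poly_growth_colweight j m_gt0))
                       (poly_growthX F poly_growth_id).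
  by rewrite mul1n.
case: inS => sP.
  by rewrite addn1; apply: (poly_growthS s (poly_growth_psum 1 GP)).
have c_ge0 : 0 <= column_term m j E F 0 by rewrite mulr_ge0 ?exprn_ge0 ?ler0n.
have cP := poly_growthS s (poly_growth_cst c_ge0).
have := poly_growthW (leq0n (2 * E + F)) cP; rewrite addn0.
case: s sP {cP} => [/(_ isT isT)[-> ->]|_]; last by rewrite andbF.
by rewrite /column_term !expr0 mulr1 oner_neq0.
Qed.

Theorem theorem4p5 (m n a b : nat) (hm : (1 <= m)%N) (hn : (1 <= n)%N) :
  exists p : {poly rat},
    size p = (2 * a + b + (n + 1) %/ 2).+1 /\
    forall d : nat, (1 <= d)%N -> (Gplus d m a b n)%:R = p.[d%:R].
Proof.
pose term (e : {ffun 'I_a -> 'I_n}) (f : {ffun 'I_b -> 'I_n}) (j : 'I_n) :=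
  column_term m j #|[set k | e k == j]| #|[set k | f k == j]|.
have GE d : (Gplus d m a b n)%:R =
    \sum_(S : {set 'I_n} | sparse S)
      \sum_(e : {ffun 'I_a -> 'I_n}) \sum_(f : {ffun 'I_b -> 'I_n})
        \prod_j (if j \in S then \sum_(x < d) term e f j (x + 1)%N
                 else term e f j 0%N).
  rewrite Gplus_heights natr_sum (partition_big (@supp d n) (@sparse n)) //=.
  apply: eq_bigr => S spS.
  transitivity (\sum_(e : {ffun 'I_a -> 'I_n}) \sum_(f : {ffun 'I_b -> 'I_n})
      \sum_(h : {ffun 'I_n -> 'I_d.+1} | supp h == S) \prod_j term e f j (h j)).
    under [RHS]eq_bigr do rewrite exchange_big.
    rewrite [RHS]exchange_big /=; apply: eq_big => [h|h _].
      by case: eqP => [->|_]; rewrite ?spS ?andbF.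
    rewrite natrM !natrX !natr_sum !expr_sum_ffun mulr_suml.
    apply: eq_bigr => e _; rewrite mulr_sumr; apply: eq_bigr => f _.
    by rewrite -big_split.
  by apply: eq_bigr => e _; apply: eq_bigr => f _; rewrite (sum_supp _ S (term e f)).
pose o := Ordinal hn.
have [p [sz_p p_k pE]] :
    poly_growth true (2 * a + b + (n + 1) %/ 2) (fun d => (Gplus d m a b n)%:R).
  apply: eq_poly_growth (fun d => esym (GE d)) _.
  apply: (@poly_growth_sum _ _ (evens n)) => [|S spS]; first exact: sparse_evens.
  apply: (@poly_growth_sum _ _ [ffun=> o]) => // e _.
  apply: (@poly_growth_sum _ _ [ffun=> o]) => // f _.
  (* [s] says that [S] is [evens n] and that both words are constant at column 1. *)
  set s := (X in poly_growth X).
  have le_deg : (2 * a + b + #|S| <= 2 * a + b + (n + 1) %/ 2)%N.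
    by rewrite leq_add2l sparse_card.
  have degE : (\sum_j (2 * #|[set k | e k == j]| + #|[set k | f k == j]| +
                       (j \in S)) = 2 * a + b + #|S|)%N.
    rewrite 2!big_split -big_distrr /= !sum_fiber_card -sum1_card.
    by rewrite [in RHS]big_mkcond.
  (* Under [s] the bound on [#|S|] is attained, so [poly_growthW] keeps the flag. *)
  have -> : s = s && (2 * a + b + #|S| == 2 * a + b + (n + 1) %/ 2)%N.
    rewrite eqn_add2l /s; case: (S =P evens n) => [->|//].
    by rewrite card_evens eqxx /= andbT.
  apply: poly_growthW => //; rewrite -degE; apply: poly_growth_prod => j.
  apply: poly_growth_factor => //.
  rewrite /s => /andP[/andP[/andP[_ /eqP->] /eqP->] /eqP->] jNS.
  (* Column 1 lies in [evens n], so a constant word misses every [j] outside it. *)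
  have no_hit c : #|[set k : 'I_c | [ffun=> o] k == j]| = 0%N.
    apply/eqP; rewrite cards_eq0; apply/eqP/setP => k; rewrite !inE ffunE.
    by apply: contraNF jNS => /eqP<-; rewrite inE.
  by rewrite !no_hit.
exists p; split=> [|d _] //; apply/eqP; rewrite eqn_leq sz_p /= ltnNge.
by apply: contraTN p_k => sz; rewrite /= nth_default ?ltxx.
Qed.
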